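(* Let $n\ge 2$, $N=n(n-1)/2$, and let $g$ be a fixed probability density on $(0,\infty)$ with $\tilde G(s)=\int_0^\infty e^{-st}g(t)\,dt$. For parameters $(q,s)$ with $q\in(0,1]$, $s\ge 0$, let the observed sample $\mathbf d=(d_1,\dots,d_e)$ of edge lengths be distributed as follows: the number of edges $e$ is binomial with $N$ trials and success probability $p=q\,\tilde G(s)$, and conditionally on $e$ the lengths $d_1,\dots,d_e$ are independent with common density $f(d\mid s)=g(d)e^{-sd}/\tilde G(s)$. Then the pair $(e,\bar d)$, where $\bar d=\frac1e\sum_{i=1}^e d_i$, is a minimal sufficient statistic for $(q,s)$.
   Context: This is the model for the edge lengths of a Waxman random graph ($n$ nodes placed independently and uniformly at random in a region, each pair at distance $d$ linked independently with probability $q e^{-sd}$) under the approximating assumption that links are independent; $g$ is the density of the distance between two independent uniformly random points of the region. When $e=0$, $\bar d$ is set to an arbitrary fixed value, e.g. $0$. *)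

(* Defs.v *)
From HB Require Import structures.
From mathcomp Require Import all_boot all_order all_algebra.
From mathcomp Require Import all_classical all_reals all_analysis.

Set Implicit Arguments.
Unset Strict Implicit.
Unset Printing Implicit Defensive.

Import Order.TTheory GRing.Theory Num.Theory.
Import numFieldNormedType.Exports.

Local Open Scope classical_set_scope.
Local Open Scope ring_scope.

(* The space of finite sequences over T, i.e. the disjoint union of the powers
   T^k, with the disjoint-union sigma-algebra: a set is measurable when its
   trace on every k.-tuple T is. *)
Definition finseq (T : Type) : Type := seq T.

Definition finseq_display : measure_display -> measure_display.
Proof. exact. Qed.

Section finseq_measurable.
Context d (T : measurableType d).

HB.instance Definition _ := Choice.copy (finseq T) (seq T).
HB.instance Definition _ := isPointed.Build (finseq T) [::].

Definition finseq_measurable : set (set (finseq T)) :=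
  [set A | forall k : nat, measurable [set t : k.-tuple T | A (tval t)]].

Let finseq_measurable0 : finseq_measurable set0.
Proof. by move=> k; exact: measurable0. Qed.

Let finseq_measurableC A : finseq_measurable A -> finseq_measurable (~` A).
Proof. by move=> mA k; exact: measurableC (mA k). Qed.

Let finseq_measurable_bigcup (F : (set (finseq T))^nat) :
  (forall i, finseq_measurable (F i)) -> finseq_measurable (\bigcup_i F i).
Proof. by move=> mF k; apply: bigcup_measurable => i _; exact: mF. Qed.

HB.instance Definition _ := @isMeasurable.Build (finseq_display d) (finseq T)
  finseq_measurable finseq_measurable0 finseq_measurableC
  finseq_measurable_bigcup.

End finseq_measurable.

Section sufficiency.
Context dX (X : measurableType dX) (R : realType) (I : Type).

(* S is sufficient for the laws P th, th in Theta: every event A has a version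
   of the conditional probability P th (A | S = y) that does not depend on th
   (Halmos and Savage). *)
Definition sufficient (Theta : set I) (P : I -> probability X R)
    dY (Y : measurableType dY) (S : X -> Y) : Prop :=
  measurable_fun [set: X] S /\
  forall A : set X, measurable A ->
    exists h : Y -> R,
      [/\ measurable_fun [set: Y] h,
          (forall y, 0 <= h y <= 1) &
          forall th, Theta th -> forall B : set Y, measurable B ->
            P th (A `&` S @^-1` B) = (\int[P th]_(x in S @^-1` B) (h (S x))%:E)%E].

(* A sufficient statistic which is, up to events that are null under every
   P th, a measurable function of each sufficient statistic. *)
Definition minimal_sufficient (Theta : set I) (P : I -> probability X R)
    dY (Y : measurableType dY) (S : X -> Y) : Prop :=
  sufficient Theta P S /\
  forall dZ (Z : measurableType dZ) (S' : X -> Z), sufficient Theta P S' ->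
    exists f : Z -> Y, measurable_fun [set: Z] f /\
      forall th, Theta th -> {ae P th, forall x, S x = f (S' x)}.

End sufficiency.

Section waxman.
Context (R : realType).
Implicit Types (g : R -> R) (q s c : R) (d : finseq R).

Definition is_density_pos g : Prop :=
  [/\ measurable_fun `]0%R:R, +oo[ g,
      (forall x, 0 < x -> 0 <= g x) &
      (\int[lebesgue_measure]_(x in `]0%R, +oo[) (g x)%:E = 1)%E].

Definition laplace g s : R :=
  \int[lebesgue_measure]_(t in `]0%R, +oo[) (expR (- (s * t)) * g t).

Definition edge_length_density g s (x : R) : R :=
  g x * expR (- (s * x)) / laplace g s.

(* The second clause is the conditional independence of the lengths given that
   there are k of them, multiplied through by the probability of that event;
   it is void when this probability vanishes (e.g. k < N when p = 1). *)
Definition waxman_law (N : nat) g q s (P : probability (finseq R) R) : Prop :=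
  (forall U : set nat,
     P [set d | U (size d)] = binomial_prob N (q * laplace g s) U) /\
  (forall (k : nat) (A : 'I_k -> set R), (forall i, measurable (A i)) ->
     P [set d | size d = k /\ forall i : 'I_k, A i (nth 0 d i)] =
     (P [set d | size d = k] *
      \prod_(i < k) \int[lebesgue_measure]_(x in `]0%R, +oo[ `&` A i)
                      (edge_length_density g s x)%:E)%E).

Definition waxman_params : set (R * R) :=
  [set th | 0 < th.1 <= 1 /\ 0 <= th.2].

Definition mean_length c d : R :=
  if size d == 0%N then c else (\sum_(x <- d) x) / (size d)%:R.

Definition edge_stat c d : nat * R := (size d, mean_length c d).

End waxman.

(* Main.v *)
Require Import Defs.
From HB Require Import structures.
From mathcomp Require Import all_boot all_order all_algebra.
From mathcomp Require Import all_classical all_reals all_analysis.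
From mathcomp Require Import measurable_realfun.
From mathcomp Require Import ring lra.

Set Implicit Arguments.
Unset Strict Implicit.
Unset Printing Implicit Defensive.

Import Order.TTheory GRing.Theory Num.Theory.
Import numFieldNormedType.Exports.

Local Open Scope classical_set_scope.
Local Open Scope ring_scope.

(** The law with parameters (1/2, 0) dominates all the others: as laplace g 0
is 1, a box of edge samples of size k has there the probability
C(N, k) 2^-N times the product of the g-masses of its sides, and the law with
parameters (q, s) has with respect to it the density
  2^N q^e (1 - q G(s))^(N - e) exp (- s (d_1 + ... + d_e)),
where G is the Laplace transform of g (lemma [waxman_density]). The unknown
factor prod_i g(d_i) has cancelled, and what is left depends on the sample
through e and the mean only, since d_1 + ... + d_e is e times the mean.

Sufficiency is then the factorization criterion ([factorization_sufficient]):
a conditional probability given the statistic, computed under the dominating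
law, is also one under each of the other laws, because their densities are
functions of the statistic.

For minimality, let S' be sufficient. By the argument of Halmos and Savage, a
conditional probability given S' that is common to the law of th and to the
dominating law forces the density of the former with respect to the latter to
be almost everywhere a function of S' ([sufficient_density]). Two densities
determine the statistic ([edge_stat_decode]): for (q, s) = (1/4, 0) the density
is (3/2)^N 3^-e, which gives e; for s = 1 and q = 1 / (1 + G(1)) the odds factor
q / (1 - q G(1)) is 1, so the density is (2 q)^N exp (- (d_1 + ... + d_e)),
which gives the sum, hence the mean. Logarithms make the statistic a measurable
function of these two densities, hence of S'. The equality holds almost
everywhere for the dominating law, hence for all of them.

Almost every step in the measure theory is one principle,
[integral_weight_transfer]: if two weighted measures have the same image under
maps to a common space, they give the same integral to the functions of these
maps. *)

(** * Integrals against images of weighted measures *)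

Section weighted_integrals.
Context (R : realType).
Import HBNNSimple.

Let mulwE d (X : measurableType d) (f w : X -> R) D :
  measurable_fun [set: X] f -> measurable_fun [set: X] w ->
  measurable_fun D (fun x => (f x * w x)%:E).
Proof.
by move=> mf mw; apply/measurable_EFinP/measurable_funTS; exact: measurable_funM.
Qed.

Section simple_functions.
Context dX (X : measurableType dX) dY (Y : measurableType dY).
Variables (mu : {measure set X -> \bar R}) (T : X -> Y) (w : X -> R).
Hypotheses (mT : measurable_fun [set: X] T) (mw : measurable_fun [set: X] w).
Hypothesis w0 : forall x, 0 <= w x.

Lemma integral_comp_nnsfun_weight (h : {nnsfun Y >-> R}) (B : set Y) :
  measurable B ->
  (\int[mu]_(x in T @^-1` B) (h (T x) * w x)%:E =
   \sum_(y \in range h)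
     (y%:E * \int[mu]_(x in T @^-1` (B `&` h @^-1` [set y])) (w x)%:E))%E.
Proof.
move=> mB.
have mTB C : measurable C -> measurable (T @^-1` C).
  by move=> mC; rewrite -[X in measurable X]setTI; exact: mT.
have mind y : measurable_fun [set: X] (\1_(T @^-1` (h @^-1` [set y])) : X -> R).
  by apply: measurable_indic; exact: mTB.
under eq_integral => x _.
  rewrite EFinM fimfunE -fsumEFin// ge0_mule_fsuml; last first.
    by move=> y; exact: nnfun_muleindic_ge0.
  over.
rewrite ge0_integral_fsum//; last 3 first.
- exact: mTB.
- move=> y; rewrite (_ : (fun x => _) =
      fun x => ((y * \1_(T @^-1` (h @^-1` [set y])) x) * w x)%:E) //.
  by apply: mulwE => //; exact: measurable_funM.
- by move=> y x _; rewrite mule_ge0 ?lee_fin// -lee_fin nnfun_muleindic_ge0.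
apply: eq_fsbigr => y; rewrite inE => -[z _ <-].
under eq_integral do rewrite EFinM -muleA.
rewrite ge0_integralZl//; last 4 first.
- exact: mTB.
- by apply: (mulwE (f := \1_(T @^-1` (h @^-1` [set h z])))).
- by move=> x _; rewrite mule_ge0 ?lee_fin.
- by rewrite lee_fin.
congr (_ * _)%E; rewrite preimage_setI [RHS]integral_mkcondr.
apply: eq_integral => x _; rewrite epatch_indic/= muleC indicE/=.
by rewrite /in_mem/= /in_set.
Qed.

Lemma integral_comp_weight_lim (f : Y -> R) (B : set Y)
    (mB : measurable B) (mf : measurable_fun B (EFin \o f)) :
  measurable_fun [set: Y] f -> (forall y, 0 <= f y) ->
  (\int[mu]_(x in T @^-1` B) (f (T x) * w x)%:E =
   limn (fun n => \int[mu]_(x in T @^-1` B)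
           (nnsfun_approx mB mf n (T x) * w x)%:E))%E.
Proof.
move=> mfT f0.
have mTB : measurable (T @^-1` B).
  by rewrite -[X in measurable X]setTI; exact: mT.
rewrite -monotone_convergence//.
- apply: eq_integral => x; rewrite inE/= => BTx.
  apply/esym/cvg_lim => //; rewrite EFinM.
  under eq_fun do rewrite EFinM.
  apply: cvgeZr => //.
  by apply: cvg_nnsfun_approx => // y _; rewrite /= lee_fin.
- move=> n; apply: mulwE => //.
  exact: measurableT_comp.
- by move=> n x _; rewrite lee_fin mulr_ge0.
- move=> x _ a b ab; rewrite lee_fin ler_wpM2r//.
  exact/lefP/nd_nnsfun_approx.
Qed.

End simple_functions.

(** The hypothesis is the case where f is an indicator; simple functions and
monotone limits give the rest. No measure with density w1 or w2 has to be
constructed. *)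
Lemma integral_weight_transfer
    d1 (X1 : measurableType d1) d2 (X2 : measurableType d2)
    dY (Y : measurableType dY)
    (mu1 : {measure set X1 -> \bar R}) (mu2 : {measure set X2 -> \bar R})
    (T1 : X1 -> Y) (T2 : X2 -> Y) (w1 : X1 -> R) (w2 : X2 -> R) :
  measurable_fun [set: X1] T1 -> measurable_fun [set: X2] T2 ->
  measurable_fun [set: X1] w1 -> measurable_fun [set: X2] w2 ->
  (forall x, 0 <= w1 x) -> (forall x, 0 <= w2 x) ->
  (forall B, measurable B ->
    \int[mu1]_(x in T1 @^-1` B) (w1 x)%:E =
    \int[mu2]_(x in T2 @^-1` B) (w2 x)%:E)%E ->
  forall f : Y -> R, measurable_fun [set: Y] f -> (forall y, 0 <= f y) ->
  forall B, measurable B ->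
    (\int[mu1]_(x in T1 @^-1` B) (f (T1 x) * w1 x)%:E =
     \int[mu2]_(x in T2 @^-1` B) (f (T2 x) * w2 x)%:E)%E.
Proof.
move=> mT1 mT2 mw1 mw2 w10 w20 w12 f mf f0 B mB.
have mfB : measurable_fun B (EFin \o f).
  exact/measurable_EFinP/measurable_funTS.
rewrite !(integral_comp_weight_lim _ _ _ _ mB mfB)//.
congr (limn _); apply/funext => n.
rewrite !integral_comp_nnsfun_weight//; apply: eq_fsbigr => y _.
by rewrite w12//; exact: measurableI.
Qed.

(** The weights 1 under nu and w under mu have the same image under the
identity. *)
Lemma integral_density d (X : measurableType d)
    (mu nu : {measure set X -> \bar R}) (w f : X -> R) :
  measurable_fun [set: X] w -> (forall x, 0 <= w x) ->
  (forall A, measurable A -> nu A = \int[mu]_(x in A) (w x)%:E)%E ->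
  measurable_fun [set: X] f -> (forall x, 0 <= f x) ->
  forall A, measurable A ->
    (\int[nu]_(x in A) (f x)%:E = \int[mu]_(x in A) (f x * w x)%:E)%E.
Proof.
move=> mw w0 nuE mf f0 A mA.
rewrite -(@integral_weight_transfer _ X _ X _ X nu mu id id (cst 1) w)//.
  by under [RHS]eq_integral do rewrite mulr1.
by move=> B mB; rewrite preimage_id -nuE// -[RHS]mul1e -integral_cst.
Qed.

Lemma integral_weight_indic d (X : measurableType d)
    (mu : {measure set X -> \bar R}) (D A : set X) (f : X -> R) :
  (\int[mu]_(x in D) (f x * \1_A x)%:E = \int[mu]_(x in A `&` D) (f x)%:E)%E.
Proof.
rewrite setIC integral_mkcondr; apply: eq_integral => x _.
by rewrite epatch_indic/= EFinM.
Qed.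

Lemma integral_weight1 d (X : measurableType d)
    (mu : {measure set X -> \bar R}) (D : set X) :
  measurable D -> (\int[mu]_(x in D) (1 : R)%:E = mu D)%E.
Proof. by move=> mD; rewrite -[RHS]mul1e -integral_cst. Qed.

End weighted_integrals.

(** * Densities of images and conditional probabilities *)

Section densities_of_images.
Context dX (X : measurableType dX) dY (Y : measurableType dY) (R : realType).

Section finite_image.
Variables (nu : {finite_measure set X -> \bar R}) (S : {mfun X >-> Y}).

(** A name for the image measure, to which the structure of a finite measure is
attached. *)
Definition finite_image := pushforward nu S.

Let finite_image0 : finite_image set0 = 0%E.
Proof. exact: measure0. Qed.

Let finite_image_ge0 A : (0 <= finite_image A)%E.
Proof. exact: measure_ge0. Qed.

Let finite_image_sigma_additive : semi_sigma_additive finite_image.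
Proof. exact: measure_semi_sigma_additive. Qed.

HB.instance Definition _ := isMeasure.Build _ _ _ finite_image
  finite_image0 finite_image_ge0 finite_image_sigma_additive.

Let finite_image_fin_num : fin_num_fun finite_image.
Proof.
move=> B mB; apply: fin_num_measure.
by rewrite -[X in measurable X]setTI; exact: measurable_funPT.
Qed.

HB.instance Definition _ :=
  Measure_isFinite.Build _ _ _ finite_image finite_image_fin_num.

End finite_image.

(** Radon-Nikodym between the two images under S, pulled back to X: psi o S is a
conditional expectation given S of the density of nu. *)
Lemma image_density (nu mu : {finite_measure set X -> \bar R}) (S : X -> Y) :
  measurable_fun [set: X] S ->
  (forall A, measurable A -> mu A = 0 -> nu A = 0)%E ->
  exists psi : Y -> R,
    [/\ measurable_fun [set: Y] psi, (forall y, 0 <= psi y) &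
        forall B, measurable B ->
          (nu (S @^-1` B) = \int[mu]_(x in S @^-1` B) (psi (S x))%:E)%E].
Proof.
move=> mS numu.
have S_mfun : isMeasurableFun _ _ X Y S by constructor.
pose T : {mfun X >-> Y} := HB.pack S S_mfun.
have dom : finite_image nu T `<< finite_image mu T.
  apply/null_content_dominatesP => B mB; apply: numu.
  by rewrite -[X in measurable X]setTI; exact: mS.
have [f [f0 ffin /integrableP[mf _] fE]] := radon_nikodym_sigma_finite dom.
exists (fine \o f); split.
- exact: measurableT_comp.
- by move=> y; exact: fine_ge0.
- move=> B mB; rewrite [LHS](fE B mB) ge0_integral_pushforward//.
    by apply: eq_integral => x _ /=; rewrite fineK.
  exact: measurable_funTS.
Qed.

(** The density f of B |-> P (A `&` S @^-1` B) is at most 1 almost everywhere,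
since that measure is below the image of P; truncating it at 1 makes the bound
hold everywhere and does not change its integrals. *)
Lemma conditional_probability_version (P : probability X R) (S : X -> Y)
    (A : set X) :
  measurable_fun [set: X] S -> measurable A ->
  exists h : Y -> R,
    [/\ measurable_fun [set: Y] h, (forall y, 0 <= h y <= 1) &
        forall B, measurable B ->
          (P (A `&` S @^-1` B) = \int[P]_(x in S @^-1` B) (h (S x))%:E)%E].
Proof.
move=> mS mA.
have [|f [mf f0 fE]] := @image_density (mrestr P mA) P S mS.
  move=> B mB PB0; apply/eqP; rewrite eq_le measure_ge0 andbT -PB0.
  by apply: le_measure; rewrite ?inE//; exact: measurableI.
have mSB B : measurable B -> measurable (S @^-1` B).
  by move=> mB; rewrite -[X in measurable X]setTI; exact: mS.
pose h y := Num.min (f y) 1.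
have mh : measurable_fun [set: Y] h by exact: measurable_minr.
exists h; split => //.
  by move=> y; rewrite /h ge_min lexx orbT le_min f0 ler01.
move=> B mB; rewrite setIC [LHS](fE B mB).
have mfS C : measurable_fun C (fun x => (f (S x))%:E).
  by apply: measurable_funTS; apply/measurable_EFinP; exact: measurableT_comp.
have mhS C : measurable_fun C (fun x => (h (S x))%:E).
  by apply: measurable_funTS; apply/measurable_EFinP; exact: measurableT_comp.
have h0 y : 0 <= h y by rewrite /h le_min f0 ler01.
pose U := [set y | 1 < f y].
have mU : measurable U.
  rewrite -[U]setTI (_ : U = f @^-1` `]1, +oo[%classic); first exact: mf.
  by apply/seteqP; split => y /=; rewrite in_itv/= andbT.
have fh C : measurable C ->
    (\int[P]_(x in S @^-1` C) (h (S x))%:E <=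
     \int[P]_(x in S @^-1` C) (f (S x))%:E)%E.
  move=> mC; apply: ge0_le_integral => //; [exact: mSB|..].
  - by move=> x _; rewrite lee_fin h0.
  - by move=> x _; rewrite lee_fin /h ge_min lexx.
have split_integral (k : Y -> R) : (forall y, 0 <= k y) ->
    (forall C, measurable_fun C (fun x => (k (S x))%:E)) ->
    (\int[P]_(x in S @^-1` B) (k (S x))%:E =
     \int[P]_(x in S @^-1` (B `&` U)) (k (S x))%:E +
     \int[P]_(x in S @^-1` (B `\` U)) (k (S x))%:E)%E.
  move=> k0 mk; rewrite -ge0_integral_setU//.
  - by rewrite -preimage_setU setUIDK.
  - by apply: mSB; exact: measurableI.
  - by apply: mSB; exact: measurableD.
  - by move=> x _; rewrite lee_fin.
  - by apply/disj_set2P; rewrite -preimage_setI setDE setIACA setICr setI0 preimage_set0.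
(* Both integrands agree off U; on U they are compared with the constant 1. *)
rewrite !split_integral//; congr (_ + _)%E; last first.
  apply: eq_integral => x; rewrite inE => -[_ /negP].
  by rewrite -leNgt => f1; rewrite /h min_l.
have mBU : measurable (B `&` U) by exact: measurableI.
apply/eqP; rewrite eq_le fh// andbT -fE//.
apply: (@le_trans _ _ (P (S @^-1` (B `&` U)))).
  by apply: le_measure; rewrite ?inE//; [apply: measurableI => //|]; exact: mSB.
rewrite -[leLHS]mul1e -integral_cst; last exact: mSB.
rewrite (_ : (\int[P]_(x in _) cst 1 x)%E =
  (\int[P]_(x in S @^-1` (B `&` U)) (h (S x))%:E)%E)//.
by apply: eq_integral => x; rewrite inE => -[_ f1]; rewrite /h min_r// ltW.
Qed.

End densities_of_images.

(** * Sufficiency in a family dominated by one of its members *)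

Section dominated_families.
Context dX (X : measurableType dX) (R : realType).

Variables (I : Type) (Theta : set I) (P : I -> probability X R) (th0 : I).

(** The version h of the conditional probability of A under P th0 serves for all
th: P th (A `&` S @^-1` B) is the integral of phi th (S x) over
A `&` S @^-1` B, where the indicator of A can be replaced by h (S x), and
phi th (S x) then turns the integral back into one under P th. *)
Lemma factorization_sufficient dY (Y : measurableType dY) (S : X -> Y)
    (phi : I -> Y -> R) :
  measurable_fun [set: X] S ->
  (forall th, Theta th -> measurable_fun [set: Y] (phi th)) ->
  (forall th y, Theta th -> 0 <= phi th y) ->
  (forall th, Theta th -> forall A, measurable A ->
     (P th A = \int[P th0]_(x in A) (phi th (S x))%:E)%E) ->
  sufficient Theta P S.
Proof.
move=> mS mphi phi0 PE; split => // A mA.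
have [h [mh h01 hE]] := conditional_probability_version (P th0) mS mA.
have h0 y : 0 <= h y by case/andP: (h01 y).
exists h; split => // th Tth B mB.
have mSB : measurable (S @^-1` B).
  by rewrite -[X in measurable X]setTI; exact: mS.
have mphiS : measurable_fun [set: X] (phi th \o S).
  by apply: measurableT_comp => //; exact: mphi.
have mhS : measurable_fun [set: X] (h \o S) by exact: measurableT_comp.
rewrite (PE _ Tth); last exact: measurableI.
rewrite (@integral_density R _ _ (P th0) (P th) (phi th \o S) (h \o S))//; first last.
- by move=> x; exact: h0.
- exact: PE.
- by move=> x; exact: phi0.
rewrite -integral_weight_indic.
rewrite (@integral_weight_transfer R _ X _ X _ Y (P th0) (P th0) S S
  (\1_A) (h \o S))//; first last.
- by move=> y; exact: phi0.
- exact: mphi.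
- move=> C mC; rewrite -hE//.
  under eq_integral do rewrite -[\1_A _]mul1r.
  rewrite integral_weight_indic integral_weight1//; apply: measurableI => //.
  by rewrite -[X in measurable X]setTI; exact: mS.
- by move=> x; exact: h0.
- by apply: eq_integral => x _; rewrite /= mulrC.
Qed.

(** Let psi (S x) be the density of P th restricted to the events that depend on
S, and h the common conditional probability of A. Then P th A is the integral
of h (S x) under P th, hence that of h (S x) psi (S x) under P th0, hence that
of psi (S x) over A under P th0. So psi (S x) is a density of P th on all
events, and densities are unique almost everywhere. *)
Lemma sufficient_density dZ (Z : measurableType dZ) (S : X -> Z) (th : I)
    (L : X -> R) :
  sufficient Theta P S -> Theta th0 -> Theta th ->
  measurable_fun [set: X] L -> (forall x, 0 <= L x) ->
  (forall A, measurable A -> P th A = \int[P th0]_(x in A) (L x)%:E)%E ->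
  exists psi : Z -> R, measurable_fun [set: Z] psi /\
    {ae P th0, forall x, L x = psi (S x)}.
Proof.
move=> [mS sufS] Tth0 Tth mL L0 PE.
have [A mA PA0|psi [mpsi psi0 psiE]] := @image_density _ X _ Z R (P th) (P th0) S mS.
  apply: (etrans (PE _ mA)); apply: null_set_integral => //.
  exact/measurable_EFinP/measurable_funTS.
exists psi; split => //.
have mpsiS : measurable_fun [set: X] (psi \o S) by exact: measurableT_comp.
suff : ae_eq (P th0) [set: X] (fun x => (L x)%:E) (fun x => (psi (S x))%:E).
  by apply: filterS => x /(_ Logic.I)[].
apply: integral_ae_eq => //.
- apply/integrableP; split; first exact/measurable_EFinP.
  under eq_integral do rewrite gee0_abs ?lee_fin//.
  by rewrite -PE// probability_setT ltry.
- exact/measurable_EFinP.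
move=> A _ mA; rewrite -PE//.
have [h [mh h01 hE]] := sufS _ mA.
have h0 y : 0 <= h y by case/andP: (h01 y).
have mhS : measurable_fun [set: X] (h \o S) by exact: measurableT_comp.
have mSB B : measurable B -> measurable (S @^-1` B).
  by move=> mB; rewrite -[X in measurable X]setTI; exact: mS.
transitivity (\int[P th0]_(x in S @^-1` setT) (h (S x) * psi (S x))%:E)%E.
  rewrite -[A]setIT -(preimage_setT S) hE//.
  under eq_integral do rewrite -[h _]mulr1.
  rewrite (@integral_weight_transfer R _ X _ X _ Z (P th) (P th0) S S
    (cst 1) (psi \o S))//.
  + by move=> x; exact: psi0.
  + move=> B mB; apply: etrans (psiE _ mB).
    by apply: integral_weight1; exact: mSB.
under [LHS]eq_integral do rewrite mulrC.
rewrite -[A in RHS]setIT -(preimage_setT S) -[RHS]integral_weight_indic.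
apply/esym; apply: (@integral_weight_transfer R _ X _ X _ Z (P th0) (P th0) S S
    (\1_A) (h \o S)) => //.
- by move=> x; exact: h0.
- move=> B mB; rewrite -hE//.
  under eq_integral do rewrite -[\1_A _]mul1r.
  by rewrite integral_weight_indic integral_weight1//;
    apply: measurableI => //; exact: mSB.
Qed.

End dominated_families.

(** * The measurable space of finite sequences *)

Section finite_sequences.
Context d (T : measurableType d) (x0 : T).

Lemma measurable_finseqP (A : set (finseq T)) :
  measurable A <-> forall k, measurable [set t : k.-tuple T | A t].
Proof. by []. Qed.

Lemma measurable_fun_finseq dY (Y : measurableType dY) (f : finseq T -> Y) :
  (forall k, measurable_fun [set: k.-tuple T] (fun t : k.-tuple T => f t)) ->
  measurable_fun [set: finseq T] f.
Proof.
move=> mf _ B mB; rewrite setTI; apply/measurable_finseqP => k.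
by have := mf k measurableT B mB; rewrite setTI.
Qed.

Lemma measurable_size : measurable_fun [set: finseq T] (fun s : finseq T => size s).
Proof.
apply: measurable_fun_finseq => k.
by rewrite (_ : (fun t : k.-tuple T => _) = cst k)//;
  apply/funext => t; rewrite size_tuple.
Qed.

Lemma measurable_nth i : measurable_fun [set: finseq T] (fun s : finseq T => nth x0 s i).
Proof.
apply: measurable_fun_finseq => k; have [ik|ki] := ltnP i k.
  rewrite (_ : (fun t : k.-tuple T => _) = (fun t => tnth t (Ordinal ik))).
    exact: measurable_tnth.
  by apply/funext => t; rewrite (tnth_nth x0).
rewrite (_ : (fun t : k.-tuple T => _) = cst x0)//.
by apply/funext => t; rewrite nth_default// size_tuple.
Qed.

Definition box k (A : 'I_k -> set T) : set (finseq T) :=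
  [set s | size s = k /\ forall i : 'I_k, A i (nth x0 s i)].

Lemma measurable_box k (A : 'I_k -> set T) :
  (forall i, measurable (A i)) -> measurable (box A).
Proof.
move=> mA; rewrite (_ : box A = [set s | size s = k] `&`
    \bigcap_(i in [set: 'I_k]) ((fun s : finseq T => nth x0 s i) @^-1` A i)); last first.
  by apply/seteqP; split => s [sk sA]; split => // i; first move=> _; exact: sA.
apply: measurableI.
  by rewrite -[X in measurable X]setTI; exact: (measurable_size _ (Y := [set k])).
apply: fin_bigcap_measurable => // i _.
by rewrite -[X in measurable X]setTI; exact: measurable_nth.
Qed.

(** A pi-system, as boxes of different lengths are disjoint. *)
Definition measurable_boxes : set (set (finseq T)) :=
  [set B | exists k (A : 'I_k -> set T), (forall i, measurable (A i)) /\ B = box A].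

(** A box with a side, so of positive length, is needed here: the only box of
length 0 contains the empty sequence. *)
Lemma measurable_boxes0 : measurable_boxes set0.
Proof.
exists 1%N, (fun=> set0); split => //.
by apply/seteqP; split => // s [_ /(_ ord0)].
Qed.

Lemma measurable_boxesI : setI_closed measurable_boxes.
Proof.
move=> _ _ [k [A [mA ->]]] [l [B [mB ->]]]; have [kl|kl] := eqVneq k l; last first.
  rewrite (_ : _ `&` _ = set0); first exact: measurable_boxes0.
  by apply/seteqP; split => // s [[sk _] [sl _]]; move/eqP: kl; rewrite -sk -sl.
rewrite -{l}kl in B mB *; exists k, (fun i => A i `&` B i); split.
  by move=> i; exact: measurableI.
apply/seteqP; split => s; first by move=> [[sk sA] [_ sB]]; split => // i; split.
by move=> [sk sAB]; split; split => // i; have [] := sAB i.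
Qed.

Let boxes_type := g_sigma_algebraType measurable_boxes.

Let measurable_box_cst k : measurable (box (fun _ : 'I_k => setT) : set boxes_type).
Proof. by apply: sub_sigma_algebra; exists k, (fun=> setT). Qed.

Let measurable_boxes_nth i :
  measurable_fun [set: boxes_type] (fun s : boxes_type => nth x0 s i).
Proof.
move=> _ B mB; rewrite setTI.
rewrite (_ : _ @^-1` _ = \bigcup_k ([set s | size s = k] `&` [set s | B (nth x0 s i)])).
  apply: bigcupT_measurable => k; have [ik|ki] := ltnP i k.
    apply: sub_sigma_algebra; exists k, (fun j => if j == i :> nat then B else setT).
    split; first by move=> j; case: ifP.
    apply/seteqP; split => s [sk sB]; split => //.
      by move=> j; case: ifPn => // /eqP ->.
    by have := sB (Ordinal ik); rewrite /= eqxx.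
  (* A sequence of length k <= i has the default x0 as its i-th term. *)
  have [Bx0|Bx0] := pselect (B x0).
    rewrite (_ : _ `&` _ = box (fun _ : 'I_k => setT)); first exact: measurable_box_cst.
    apply/seteqP; split => s [sk _]; split => //=.
    by rewrite nth_default// sk.
  rewrite (_ : _ `&` _ = set0)//.
  by apply/seteqP; split => // s [sk /=]; rewrite nth_default// sk.
by apply/seteqP; split => s /= => [Bs|[? _ []]//]; exists (size s).
Qed.

(** A measurable set A is the union over k of its parts of length k, and each of
these is the preimage, among the sequences of length k, of the trace of A on
k-tuples under the map r k that reads the first k coordinates. That map is
measurable for the sigma-algebra generated by the boxes, because each coordinate
is. *)
Lemma measurable_finseqE : @measurable _ (finseq T) = <<s measurable_boxes >>.
Proof.
apply/seteqP; split => [A mA|]; last first.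
  apply: smallest_sub; first exact: sigma_algebra_measurable.
  by move=> _ [k [B [mB ->]]]; exact: measurable_box.
pose r k (s : boxes_type) : k.-tuple T := [tuple nth x0 s i | i < k].
have mr k : measurable_fun [set: boxes_type] (r k).
  apply/measurable_fun_tnthP => i.
  rewrite (_ : _ \o _ = fun s : boxes_type => nth x0 s i).
    exact: measurable_boxes_nth.
  by apply/funext => s; rewrite /= tnth_mktuple.
change (measurable (A : set boxes_type)).
rewrite (_ : A = \bigcup_k (box (fun _ : 'I_k => setT) `&`
    r k @^-1` [set t : k.-tuple T | A t])); last first.
  have rE k s : size s = k -> r k s = s :> seq T.
    move=> sk; apply: (@eq_from_nth _ x0); rewrite size_tuple// => i ik.
    by rewrite (nth_mktuple _ _ (Ordinal ik)).
  apply/seteqP; split => s /=.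
    by move=> As; exists (size s) => //; split => //=; rewrite rE.
  by move=> [k _ [[sk _]]] /=; rewrite rE.
apply: bigcupT_measurable => k; apply: measurableI; first exact: measurable_box_cst.
rewrite -[X in measurable X]setTI; apply: mr => //.
by move/measurable_finseqP : mA; exact.
Qed.

(** Uniqueness of finite measures that agree on a pi-system, with one of the two
measures given by its density. The total masses agree because the whole space is
the disjoint union of the full boxes. *)
Lemma finseq_density (R : realType) (mu nu : probability (finseq T) R)
    (w : finseq T -> R) :
  measurable_fun [set: finseq T] w -> (forall s, 0 <= w s) ->
  (forall k (A : 'I_k -> set T), (forall i, measurable (A i)) ->
     (nu (box A) = \int[mu]_(s in box A) (w s)%:E)%E) ->
  forall A, measurable A -> (nu A = \int[mu]_(s in A) (w s)%:E)%E.
Proof.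
move=> mw w0 nuE A; rewrite measurable_finseqE.
have mwE D : measurable_fun D (fun s => (w s)%:E).
  by apply: measurable_funTS; exact/measurable_EFinP.
have bigcupE (F : (set (finseq T))^nat) : (forall n, measurable (F n)) ->
    trivIset [set: nat] F ->
    (forall n, nu (F n) = \int[mu]_(s in F n) (w s)%:E)%E ->
    (nu (\bigcup_n F n) = \int[mu]_(s in \bigcup_n F n) (w s)%:E)%E.
  move=> mF tF FE; rewrite measure_bigcup// ge0_integral_bigcup//; last first.
    by move=> s _; rewrite lee_fin.
  rewrite (@eq_eseriesl _ _ xpredT); last by move=> n; rewrite in_setT.
  by apply: eq_eseriesr => n _; exact: FE.
have total : (nu [set: finseq T] = \int[mu]_s (w s)%:E)%E.
  have -> : [set: finseq T] = \bigcup_k box (fun _ : 'I_k => setT).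
    by apply/seteqP; split => // s _; exists (size s).
  apply: bigcupE.
  - by move=> k; exact: measurable_box.
  - by apply/trivIsetP => i j _ _ ij; apply/seteqP; split => // s [[si _] [sj _]];
      move/eqP: ij; rewrite -si -sj.
  - by move=> k; exact: nuE.
apply: (@dynkin_induction _ _ measurable_boxes
  (fun B => nu B = \int[mu]_(s in B) (w s)%:E)%E) => //.
- exact: measurable_finseqE.
- exact: measurable_boxesI.
- by move=> _ [k [B [mB ->]]]; exact: nuE.
- move=> B mB BE.
  have nuB : nu B \is a fin_num by exact: fin_num_measure.
  have mCB : measurable (~` B) by exact: measurableC.
  have := total; rewrite -(setUv B) measureU//; last exact: setICr.
  rewrite ge0_integral_setU//; last 2 first.
  + by move=> s _; rewrite lee_fin.
  + by apply/disj_set2P; exact: setICr.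
  move=> /(congr1 (fun z => z - nu B)%E).
  by rewrite -BE ![(nu B + _)%E]addeC !addeK//.
Qed.

End finite_sequences.

(** * Independent coordinates *)

Section independent_coordinates.
Context d (T : measurableType d) (x0 : T) (R : realType).
Variables (mu : {measure set (finseq T) -> \bar R}).
(* The i-th coordinate is distributed as the image by pi of the measure with
   density r with respect to nu. *)
Context dU (U : measurableType dU).
Variables (nu : {measure set U -> \bar R}) (pi : U -> T).
Variables (k : nat) (C : \bar R) (r : U -> R) (u : T -> R).
Hypothesis mpi : measurable_fun [set: U] pi.
Hypotheses (mr : measurable_fun [set: U] r) (r0 : forall x, 0 <= r x).
Hypotheses (m_u : measurable_fun [set: T] u) (u0 : forall x, 0 <= u x).
Hypotheses (C0 : (0 <= C)%E) (Cfin : C \is a fin_num).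
Hypothesis rfin : forall A, measurable A ->
  (\int[nu]_(x in pi @^-1` A) (r x)%:E)%E \is a fin_num.
Hypothesis urfin : forall A, measurable A ->
  (\int[nu]_(x in pi @^-1` A) (u (pi x) * r x)%:E)%E \is a fin_num.
Hypothesis muE : forall A : 'I_k -> set T, (forall i, measurable (A i)) ->
  (mu (box x0 A) = C * \prod_(i < k) \int[nu]_(x in pi @^-1` A i) (r x)%:E)%E.

(* The weights of the first j coordinates. *)
Let v (j i : nat) (x : T) : R := if (i < j)%N then u x else 1.

Let v0 j i x : 0 <= v j i x. Proof. by rewrite /v; case: ifP. Qed.

Let mv j i : measurable_fun [set: T] (v j i).
Proof. by rewrite /v; case: (i < j)%N. Qed.

Let upd (A : 'I_k -> set T) (i : 'I_k) (B : set T) (l : 'I_k) :=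
  if l == i then B else A l.

Let mupd A i B : (forall l, measurable (A l)) -> measurable B ->
  forall l, measurable (upd A i B l).
Proof. by move=> mA mB l; rewrite /upd; case: ifP. Qed.

Let box_upd A (i : 'I_k) B :
  box x0 (upd A i setT) `&` (fun s : finseq T => nth x0 s i) @^-1` B =
  box x0 (upd A i B).
Proof.
apply/seteqP; split => s.
  move=> [[sk sA] /= sB]; split => // l; have := sA l; rewrite /upd.
  by case: eqP => [->|].
move=> [sk sA]; split; last by have := sA i; rewrite /upd eqxx.
by split => // l; have := sA l; rewrite /upd; case: eqP.
Qed.

Let mpre B : measurable B -> measurable (pi @^-1` B).
Proof. by move=> mB; rewrite -[X in measurable X]setTI; exact: mpi. Qed.

(* Passing from j to j.+1: with the other sides of the box fixed, the weighted
   integral over the box is, as a function of the side number j, the measure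
   with density K r, where K is the contribution of the other coordinates. So the
   additional weight u, which depends on the j-th coordinate only, can be
   integrated against that measure. *)
Let integral_box_partial_prod j : (j <= k)%N ->
  forall A : 'I_k -> set T, (forall i, measurable (A i)) ->
  (\int[mu]_(s in box x0 A) (\prod_(i < k) v j i (nth x0 s i))%:E =
   C * \prod_(i < k) \int[nu]_(x in pi @^-1` A i) (v j i (pi x) * r x)%:E)%E.
Proof.
elim: j => [_ A mA|j IH jk A mA].
  rewrite (eq_integral (fun=> 1%:E)); last first.
    by move=> s _; rewrite big1.
  rewrite integral_weight1; last exact: measurable_box.
  by rewrite muE//; congr (_ * _)%E; apply: eq_bigr => i _;
    apply: eq_integral => x _; rewrite mul1r.
pose jo := Ordinal jk.
pose w s := \prod_(i < k) v j i (nth x0 s i).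
have w0 s : 0 <= w s by apply: prodr_ge0 => i _.
have mw : measurable_fun [set: finseq T] w.
  apply: measurable_prod => i _.
  by apply: (measurableT_comp (mv j i)); exact: measurable_nth.
pose K0 := (C *
  \prod_(i < k | i != jo) \int[nu]_(x in pi @^-1` A i) (v j i (pi x) * r x)%:E)%E.
have K0_ge0 : (0 <= K0)%E.
  rewrite mule_ge0//; apply: prode_ge0 => i _.
  by apply: integral_ge0 => x _; rewrite lee_fin mulr_ge0.
have K0_fin : K0 \is a fin_num.
  rewrite fin_numM//; apply: prode_fin_num => i _; rewrite /v; case: (i < j)%N.
    exact: urfin.
  by under eq_integral do rewrite mul1r; exact: rfin.
pose K := fine K0.
have KE : K%:E = K0 by rewrite fineK.
have K_ge0 : 0 <= K by exact: fine_ge0.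
pose mnth := measurable_nth x0 j.
have mE : measurable (box x0 (upd A jo setT)).
  by apply: measurable_box; exact: mupd.
have transfer := @integral_weight_transfer R _ (finseq T) _ U _ T mu nu
  (fun s => nth x0 s j) pi (fun s => w s * \1_(box x0 (upd A jo setT)) s)
  (fun x => K * r x) mnth.
have : (\int[mu]_(s in (fun s : finseq T => nth x0 s j) @^-1` A jo)
     (u (nth x0 s j) * w s * \1_(box x0 (upd A jo setT)) s)%:E =
   \int[nu]_(x in pi @^-1` A jo) (u (pi x) * (K * r x))%:E)%E.
  under [LHS]eq_integral do rewrite -mulrA.
  apply: transfer => //.
  - by apply: measurable_funM => //; exact: measurable_indic.
  - exact: measurable_funM.
  - by move=> s; rewrite mulr_ge0.
  - by move=> x; rewrite mulr_ge0.
  move=> B mB; rewrite integral_weight_indic (box_upd A jo) IH; last 2 first.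
  - exact: ltnW.
  - exact: mupd.
  under [RHS]eq_integral do rewrite EFinM.
  rewrite ge0_integralZl//; last 3 first.
  - exact: mpre.
  - by apply: measurable_funTS; exact/measurable_EFinP.
  - by move=> x _; rewrite lee_fin.
  rewrite KE /K0 -muleA (bigD1 jo)//= [X in (C * X)%E]muleC; congr (C * (_ * _))%E.
    by apply: eq_bigr => i /negPf ij; rewrite /upd ij.
  rewrite /upd eqxx; apply: eq_integral => x _.
  by rewrite /v ltnn mul1r.
rewrite integral_weight_indic (box_upd A jo).
rewrite (_ : upd A jo (A jo) = A); last first.
  by apply/funext => i; rewrite /upd; case: eqP => // ->.
move=> E.
have vS (i : 'I_k) : i != jo -> v j.+1 i = v j i.
  by move=> ij; rewrite /v ltnS [(i <= j)%N]leq_eqVlt -(inj_eq val_inj) /= in ij *;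
    rewrite (negbTE ij).
have stepE s : \prod_(i < k) v j.+1 i (nth x0 s i) = u (nth x0 s j) * w s.
  rewrite /w (bigD1 jo)//= [in RHS](bigD1 jo)//= {1 3}/v ltnSn ltnn mul1r.
  by congr (_ * _); apply: eq_bigr => i ij; rewrite vS.
under [LHS]eq_integral do rewrite stepE.
rewrite E; under [LHS]eq_integral do rewrite mulrCA EFinM.
rewrite ge0_integralZl//; last 3 first.
- exact: mpre.
- apply: measurable_funTS; apply/measurable_EFinP; apply: measurable_funM => //.
  exact: measurableT_comp.
- by move=> x _; rewrite lee_fin mulr_ge0.
rewrite KE /K0 -muleA; congr (C * _)%E.
rewrite [RHS](bigD1 jo)//= muleC; congr (_ * _)%E.
  by apply: eq_integral => x _; rewrite /v ltnSn.
by apply: eq_bigr => i ij; rewrite vS.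
Qed.

(** Fubini for coordinates that are independent on the event that the length
is k, without a product measure: the weights are put in one coordinate at a
time. *)
Lemma integral_box_prod (A : 'I_k -> set T) : (forall i, measurable (A i)) ->
  (\int[mu]_(s in box x0 A) (\prod_(i < k) u (nth x0 s i))%:E =
   C * \prod_(i < k) \int[nu]_(x in pi @^-1` A i) (u (pi x) * r x)%:E)%E.
Proof.
move=> mA; have := integral_box_partial_prod (leqnn k) mA.
have vk s : \prod_(i < k) v k i (nth x0 s i) = \prod_(i < k) u (nth x0 s i).
  by apply: eq_bigr => i _; rewrite /v ltn_ord.
under [X in X = _ -> _]eq_integral do rewrite vk.
move=> ->; congr (C * _)%E; apply: eq_bigr => i _; apply: eq_integral => x _.
by rewrite /v ltn_ord.
Qed.

End independent_coordinates.

(** * Exponential tilting of the edge length density *)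

Section edge_lengths.
Context (R : realType) (g : R -> R).
Hypothesis hg : is_density_pos g.

Local Notation D := (`]0%R : R, +oo[%classic : set R).
Local Notation leb := (@lebesgue_measure R).

(** As g is measurable and nonnegative on the positive half-line only, it is
replaced by its extension by 0 to all of R. *)
Definition extend0 (t : R) : R := if 0 < t then g t else 0.

Lemma extend0_ge0 t : 0 <= extend0 t.
Proof. by rewrite /extend0; case: ifPn => // t0; case: hg => _ /(_ _ t0). Qed.

Lemma measurable_extend0 : measurable_fun [set: R] extend0.
Proof.
have [mg _ _] := hg; apply: measurable_fun_if => //.
- apply: measurable_fun_ltr => //.
- apply: measurable_funS mg => // t [_ /=].
  by rewrite in_itv/= andbT.
Qed.

Lemma integral_extend0 (u : R -> R) (A : set R) :
  (\int[leb]_(t in D `&` A) (u t * g t)%:E =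
   \int[leb]_(t in A) (u t * extend0 t)%:E)%E.
Proof.
rewrite integral_mkcondl; apply: eq_integral => t _.
rewrite /extend0 patchE mem_setE in_itv/= andbT.
by case: ifP => // _; rewrite mulr0.
Qed.

Lemma integral_extend0T : (\int[leb]_t (extend0 t)%:E = 1)%E.
Proof.
case: hg => _ _ <-; rewrite -[X in (\int[leb]_(t in X) (g t)%:E)%E]setIT.
under [RHS]eq_integral do rewrite -[g _]mul1r.
by rewrite integral_extend0; apply: eq_integral => t _; rewrite mul1r.
Qed.

Definition tilt (s t : R) : R := expR (- (s * t)).

Lemma tilt_ge0 s t : 0 <= tilt s t. Proof. exact: expR_ge0. Qed.

Lemma measurable_tilt s : measurable_fun [set: R] (tilt s).
Proof. by apply: measurableT_comp => //; apply: measurableT_comp. Qed.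

Lemma integral_tilt0 (A : set R) :
  (\int[leb]_(t in A) (tilt 0 t * extend0 t)%:E =
   \int[leb]_(t in A) (extend0 t)%:E)%E.
Proof. by apply: eq_integral => t _; rewrite /tilt mul0r oppr0 expR0 mul1r. Qed.

Lemma tilted_mass_fin s (A : set R) : 0 <= s -> measurable A ->
  (\int[leb]_(t in A) (tilt s t * extend0 t)%:E)%E \is a fin_num /\
  (\int[leb]_(t in A) (tilt s t * extend0 t)%:E <= 1)%E.
Proof.
move=> s0 mA.
suff le1 : (\int[leb]_(t in A) (tilt s t * extend0 t)%:E <= 1)%E.
  split => //; rewrite ge0_fin_numE; first exact: le_lt_trans le1 (ltry _).
  by apply: integral_ge0 => t _; rewrite lee_fin mulr_ge0// ?tilt_ge0 ?extend0_ge0.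
rewrite -integral_extend0T.
apply: (@le_trans _ _ (\int[leb]_(t in A) (extend0 t)%:E)%E).
  apply: ge0_le_integral => //.
  - by move=> t _; rewrite lee_fin mulr_ge0// ?tilt_ge0 ?extend0_ge0.
  - apply: measurable_funTS; apply/measurable_EFinP.
    by apply: measurable_funM; [exact: measurable_tilt|exact: measurable_extend0].
  - by apply: measurable_funTS; apply/measurable_EFinP; exact: measurable_extend0.
  - move=> t _; rewrite lee_fin /extend0; case: ifPn => [t0|_]; last by rewrite mulr0.
    have g0 : 0 <= g t by case: hg => _ /(_ _ t0).
    by rewrite ler_piMl// /tilt -expR0 ler_expR oppr_le0 mulr_ge0// ltW.
apply: ge0_subset_integral => //.
- by apply/measurable_EFinP; exact: measurable_extend0.
- by move=> t _; rewrite lee_fin extend0_ge0.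
Qed.

Definition tilted_mass s (A : set R) : R :=
  fine (\int[leb]_(t in A) (tilt s t * extend0 t)%:E).

Lemma tilted_massE s A : 0 <= s -> measurable A ->
  (\int[leb]_(t in A) (tilt s t * extend0 t)%:E = (tilted_mass s A)%:E)%E.
Proof. by move=> s0 mA; rewrite fineK//; have [] := tilted_mass_fin s0 mA. Qed.

Lemma laplaceE s : laplace g s = tilted_mass s setT.
Proof.
by rewrite /laplace /Rintegral /tilted_mass -integral_extend0 setIT.
Qed.

Lemma laplace0 : laplace g 0 = 1.
Proof.
by rewrite laplaceE /tilted_mass integral_tilt0 integral_extend0T.
Qed.

Lemma laplace_le1 s : 0 <= s -> laplace g s <= 1.
Proof.
move=> s0; rewrite laplaceE -lee_fin -tilted_massE//.
by have [] := tilted_mass_fin s0 measurableT.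
Qed.

(** If the transform vanished, g would be 0 almost everywhere because the
exponential is positive, and its integral could not be 1. *)
Lemma laplace_gt0 s : 0 <= s -> 0 < laplace g s.
Proof.
move=> s0; rewrite lt0r; apply/andP; split; last first.
  rewrite laplaceE -lee_fin -tilted_massE//; apply: integral_ge0 => t _.
  by rewrite lee_fin mulr_ge0// ?tilt_ge0 ?extend0_ge0.
apply/eqP; rewrite laplaceE => G0.
have mt : measurable_fun [set: R] (fun t => (tilt s t * extend0 t)%:E).
  apply/measurable_EFinP.
  by apply: measurable_funM; [exact: measurable_tilt|exact: measurable_extend0].
have : (\int[leb]_t `|(tilt s t * extend0 t)%:E| = 0)%E.
  under eq_integral => t _.
    rewrite gee0_abs; last by rewrite lee_fin mulr_ge0// ?tilt_ge0 ?extend0_ge0.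
    over.
  by rewrite tilted_massE// G0.
move=> /(proj1 (ae_eq_integral_abs leb measurableT mt)) ae0.
have : (\int[leb]_t (extend0 t)%:E = \int[leb]_(t in [set: R]) cst 0 t)%E.
  apply: ae_eq_integral => //.
  - by apply/measurable_EFinP; exact: measurable_extend0.
  - apply: filterS ae0 => t /(_ Logic.I) /eqP; rewrite /= eqe mulf_eq0.
    by rewrite /tilt gt_eqF ?expR_gt0//= => /eqP ->.
rewrite integral_extend0T integral0 => /eqP.
by rewrite eqe oner_eq0.
Qed.

Lemma integral_edge_length_density s A : 0 <= s -> measurable A ->
  (\int[leb]_(t in D `&` A) (edge_length_density g s t)%:E =
   ((laplace g s)^-1 * tilted_mass s A)%:E)%E.
Proof.
move=> s0 mA; rewrite EFinM -tilted_massE// -ge0_integralZl//; last 3 first.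
- apply: measurable_funTS; apply/measurable_EFinP.
  by apply: measurable_funM; [exact: measurable_tilt|exact: measurable_extend0].
- by move=> t _; rewrite lee_fin mulr_ge0// ?tilt_ge0 ?extend0_ge0.
- by rewrite lee_fin invr_ge0 ltW// laplace_gt0.
under [RHS]eq_integral do rewrite -EFinM mulrA.
rewrite -integral_extend0; apply: eq_integral => t _; congr (_%:E).
by rewrite /edge_length_density /tilt mulrC [g t * _]mulrC mulrA.
Qed.

End edge_lengths.

(** * The likelihood of the model *)

Section waxman_likelihood.
Context (R : realType) (N : nat) (g : R -> R).
Hypothesis hg : is_density_pos g.

Lemma edge_prob_itv (q s : R) : 0 < q <= 1 -> 0 <= s -> 0 <= q * laplace g s <= 1.
Proof.
move=> /andP[q0 q1] s0; have G0 := laplace_gt0 hg s0.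
rewrite mulr_ge0 /=; [|exact: ltW..].
by rewrite -[leRHS]mulr1 ler_pM//; [exact: ltW..|exact: laplace_le1].
Qed.

Lemma waxman_size_law (q s : R) (P : probability (finseq R) R) k :
  0 < q <= 1 -> 0 <= s -> waxman_law N g q s P ->
  P [set d | size d = k] = (binomial_pmf N (q * laplace g s) k)%:E.
Proof.
move=> q01 s0 [hsize _]; rewrite (hsize [set k]) /binomial_prob.
rewrite edge_prob_itv// esum_set1// lee_fin binomial_pmf_ge0//.
exact: edge_prob_itv.
Qed.

Lemma waxman_box_law (q s : R) (P : probability (finseq R) R) k (A : 'I_k -> set R) :
  0 < q <= 1 -> 0 <= s -> waxman_law N g q s P ->
  (forall i, measurable (A i)) ->
  P (box (0 : R)%R A) = (binomial_pmf N (q * laplace g s) k *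
                 \prod_(i < k) ((laplace g s)^-1 * tilted_mass g s (A i)))%:E.
Proof.
move=> q01 s0 hP mA; have [_ hbox] := hP.
rewrite [LHS](hbox k A mA) (waxman_size_law k q01 s0 hP) EFinM -prodEFin.
by congr (_ * _)%E; apply: eq_bigr => i _; rewrite integral_edge_length_density.
Qed.

(** Density of the law with parameters th with respect to the law with parameters
(1/2, 0), as a function of the number of edges and of their mean length. The
product of these two is the total length, also when there is no edge and the
mean is a convention. *)
Definition likelihood (th : R * R) (y : nat * R) : R :=
  2 ^+ N * th.1 ^+ y.1 * (1 - th.1 * laplace g th.2) ^+ (N - y.1) *
  tilt th.2 (y.1%:R * y.2).

Lemma likelihood_ge0 th y : waxman_params th -> 0 <= likelihood th y.
Proof.
case: th => q s [/= q01 s0]; rewrite /likelihood /= !mulr_ge0 ?exprn_ge0 ?tilt_ge0//.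
  by case/andP: q01 => /ltW.
by have /andP[_] := edge_prob_itv q01 s0; rewrite subr_ge0.
Qed.

Lemma mean_lengthE c (d : finseq R) :
  (size d)%:R * mean_length c d = \sum_(i < size d) nth 0 d i.
Proof.
rewrite /mean_length (big_nth 0) big_mkord; case: eqP => [d0|/eqP d0].
  by rewrite d0 mul0r big_ord0.
by rewrite mulrC divfK// pnatr_eq0.
Qed.

(** For k > N both sides vanish with the binomial coefficient, although the
exponent N - k is truncated there. *)
Lemma binomial_pmf_ratio (q G : R) k : G != 0 ->
  binomial_pmf N (q * G) k * G^-1 ^+ k =
  2 ^+ N * q ^+ k * (1 - q * G) ^+ (N - k) * binomial_pmf N (2^-1 : R) k.
Proof.
move=> G0; rewrite /binomial_pmf; have [kN|Nk] := leqP k N; last first.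
  by rewrite bin_small// !mulr0n mul0r mulr0.
have half : 1 - 2^-1 = 2^-1 :> R by field.
rewrite /unstable.onem half -exprD subnKC// mulrnAl mulrnAr exprMn; congr (_ *+ _).
rewrite !exprVn; have G0k : G ^+ k != 0 by rewrite expf_neq0.
have two0 : (2 : R) ^+ N != 0 by rewrite expf_neq0.
move: (2 ^+ N : R) two0 (G ^+ k) G0k => t t0 x x0.
by field; rewrite t0 x0.
Qed.

Lemma measurable_likelihood th : measurable_fun [set: nat * R] (likelihood th).
Proof.
apply: measurable_funM.
  apply: (@measurableT_comp _ _ _ _ _ _ (fun k : nat => 2 ^+ N * th.1 ^+ k *
     (1 - th.1 * laplace g th.2) ^+ (N - k)) _ fst) => //.
apply: (measurableT_comp (measurable_tilt _)).
apply: measurable_funM => //.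
apply: (@measurableT_comp _ _ _ _ _ _ (fun k : nat => k%:R : R) _ fst) => //.
Qed.

Lemma measurable_edge_stat c : measurable_fun [set: finseq R] (edge_stat c).
Proof.
apply: measurable_fun_pair; first exact: measurable_size.
apply: measurable_fun_finseq => k.
have [k0|k0] := eqVneq k 0%N.
  rewrite (_ : (fun t : k.-tuple R => _) = cst c)//.
  by apply/funext => t; rewrite /mean_length size_tuple; case: eqP.
rewrite (_ : (fun t : k.-tuple R => _) = fun t => (\sum_(i < k) tnth t i) / k%:R).
  apply: measurable_funM => //.
  by apply: measurable_sum => i; exact: measurable_tnth.
by apply/funext => t; rewrite /mean_length size_tuple (negbTE k0) big_tuple.
Qed.

(** By [finseq_density] it is enough to look at boxes. There the likelihood is a
constant times a product over the coordinates, which [integral_box_prod]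
integrates; the powers of the Laplace transform that normalize the edge length
density cancel against those in the binomial weight. *)
Lemma waxman_density (q s c : R) (P P0 : probability (finseq R) R) :
  0 < q <= 1 -> 0 <= s -> waxman_law N g q s P -> waxman_law N g 2^-1 0 P0 ->
  forall A, measurable A ->
    (P A = \int[P0]_(d in A) (likelihood (q, s) (edge_stat c d))%:E)%E.
Proof.
move=> q01 s0 hP hP0.
have half01 : 0 < (2^-1 : R) <= 1 by lra.
have lik0 d : 0 <= likelihood (q, s) (edge_stat c d) by exact: likelihood_ge0.
apply: (finseq_density (x0 := 0 : R)) => //.
  by apply: (measurableT_comp (measurable_likelihood _)); exact: measurable_edge_stat.
move=> k A mA.
pose C := 2 ^+ N * q ^+ k * (1 - q * laplace g s) ^+ (N - k).
have C0 : 0 <= C.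
  have := likelihood_ge0 (k, 0) (conj q01 s0 : waxman_params (q, s)).
  by rewrite /likelihood /= mulr0 /tilt mulr0 oppr0 expR0 mulr1.
rewrite (eq_integral (fun d : finseq R => C%:E * (\prod_(i < k) tilt s (nth 0 d i))%:E)%E);
  last first.
  move=> d; rewrite inE => -[dk _]; rewrite -EFinM; congr (_%:E).
  rewrite /likelihood /= mean_lengthE dk; congr (_ * _).
  by rewrite /tilt mulr_sumr -sumrN expR_sum.
rewrite ge0_integralZl//; last 3 first.
- exact: measurable_box.
- apply: measurable_funTS; apply/measurable_EFinP; apply: measurable_prod => i _.
  by apply: (measurableT_comp (measurable_tilt s)); exact: measurable_nth.
- by move=> d _; rewrite lee_fin prodr_ge0// => i _; exact: tilt_ge0.
have pmf0 : 0 <= binomial_pmf N (2^-1 : R) k by apply: binomial_pmf_ge0; lra.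
have -> : (\int[P0]_(d in box (0 : R)%R A) (\prod_(i < k) tilt s (nth 0%R d i))%:E =
    (binomial_pmf N (2^-1)%R k * \prod_(i < k) tilted_mass g s (A i))%R%:E)%E.
  rewrite EFinM -prodEFin.
  have massE i : (tilted_mass g s (A i))%:E =
      (\int[@lebesgue_measure R]_(t in A i) (tilt s t * extend0 g t)%:E)%E.
    by rewrite -tilted_massE//; exact: mA.
  under [in RHS]eq_bigr do rewrite massE.
  apply: (@integral_box_prod _ _ (0 : R)%R R P0 _ (measurableTypeR R)
    (@lebesgue_measure R) id k _ (extend0 g) (tilt s)) => //.
  - exact: measurable_extend0.
  - exact: extend0_ge0.
  - exact: measurable_tilt.
  - exact: tilt_ge0.
  - move=> B mB; have [+ _] := tilted_mass_fin hg (lexx 0) mB.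
    by rewrite integral_tilt0.
  - by move=> B mB; have [] := tilted_mass_fin hg s0 mB.
  - move=> B mB; apply: (etrans (waxman_box_law half01 (lexx 0) hP0 mB)).
    rewrite laplace0// mulr1 EFinM -prodEFin; congr (_ * _)%E.
    apply: eq_bigr => i _; rewrite invr1 mul1r -tilted_massE//; last exact: mB.
    exact: integral_tilt0.
rewrite (waxman_box_law q01 s0 hP mA) big_split/= prodr_const card_ord mulrA.
rewrite binomial_pmf_ratio; last by rewrite gt_eqF// laplace_gt0.
by rewrite -EFinM mulrA.
Qed.

End waxman_likelihood.

(** * Recovering the statistic from two densities *)

Section decoding.
Context (R : realType).

(** The target is discrete, so the fibres suffice; that of 0 contains the
negative numbers. *)
Lemma measurable_truncn : measurable_fun [set: R] (@Num.truncn R).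
Proof.
move=> _ U _; rewrite setTI.
have -> : @Num.truncn R @^-1` U = \bigcup_(n in U) (@Num.truncn R @^-1` [set n]).
  apply/seteqP; split=> x /=; [|by move=> [n Un /= ->]].
  by exists (Num.truncn x).
apply: bigcup_measurable => -[|n] _.
  rewrite (_ : _ @^-1` _ = `]-oo, 1[%classic)//.
  apply/seteqP; split => x /=; rewrite in_itv/=.
    by move/truncn0Pn; rewrite -ltNge.
  by move=> x1; apply/truncn0Pn; rewrite -ltNge.
rewrite (_ : _ @^-1` _ = `[n.+1%:R, n.+2%:R[%classic)//.
apply/seteqP; split => x /=; rewrite in_itv/=.
  move=> xn; have x0 : 0 <= x.
    by rewrite (le_trans ler01)// -truncn_gt0 xn.
  by rewrite -truncn_eq//; apply/eqP.
move=> xn; apply/eqP; rewrite truncn_eq//.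
by case/andP: xn => + _; apply: le_trans.
Qed.

(** The inverse of u = a 3^-k and v = b exp (- k m), with m = c for k = 0. *)
Definition decode (a b c u v : R) : nat * R :=
  let k := Num.truncn ((ln a - ln u) / ln 3) in
  (k, if k == 0%N then c else (ln b - ln v) / k%:R).

Lemma measurable_decode a b c d (Z : measurableType d) (p1 p2 : Z -> R) :
  measurable_fun [set: Z] p1 -> measurable_fun [set: Z] p2 ->
  measurable_fun [set: Z] (fun z => decode a b c (p1 z) (p2 z)).
Proof.
move=> m1 m2.
have mlog (e : R) (p : Z -> R) : measurable_fun [set: Z] p ->
    measurable_fun [set: Z] (fun z => ln e - ln (p z)).
  move=> mp; apply: measurable_funB => //.
  exact: (measurableT_comp (@measurable_ln R)).
have mk : measurable_fun [set: Z] (fun z => Num.truncn ((ln a - ln (p1 z)) / ln 3)).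
  apply: (measurableT_comp measurable_truncn); apply: measurable_funM => //.
  exact: mlog.
apply: measurable_fun_pair => //; apply: measurable_fun_ifT.
- exact: (measurableT_comp (f := fun k : nat => k == 0%N)).
- exact: measurable_cst.
- apply: measurable_funM; first exact: mlog.
  exact: (measurableT_comp (f := fun k : nat => k%:R^-1 : R)).
Qed.

Variables (N : nat) (g : R -> R).
Hypothesis hg : is_density_pos g.

(** The value of q for which q = 1 - q G(1): the weights of a present and of an
absent link in the likelihood are then equal, and the number of edges
disappears from it except through the total length. *)
Definition balanced_prob : R := (1 + laplace g 1)^-1.

Lemma balanced_prob_itv : 0 < balanced_prob <= 1.
Proof.
have G0 := laplace_gt0 hg (@ler01 R).
by rewrite /balanced_prob invr_gt0 addr_gt0//= invf_le1 ?addr_gt0// lerDl ltW.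
Qed.

(** The bound on the size is what makes (1 - p)^(N - e) an exact power. *)
Lemma edge_stat_decode c (d : finseq R) : (size d <= N)%N ->
  edge_stat c d =
  decode ((3 / 2) ^+ N) ((2 * balanced_prob) ^+ N) c
    (likelihood N g (4^-1, 0) (edge_stat c d))
    (likelihood N g (balanced_prob, 1) (edge_stat c d)).
Proof.
move=> dN; have [q0 _] := andP balanced_prob_itv.
rewrite /edge_stat /likelihood /=; set k := size d; set m := mean_length c d.
have kN : (k + (N - k) = N)%N by rewrite subnKC.
have lnMB (x y : R) : 0 < x -> 0 < y -> ln (x * y) - ln y = ln x.
  by move=> x0 y0; rewrite lnM ?posrE// addrK.
have lik1 : (3 / 2) ^+ N = 3 ^+ k * (2 ^+ N * 4^-1 ^+ k *
    (1 - 4^-1 * laplace g 0) ^+ (N - k) * tilt 0 (k%:R * m)).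
  rewrite laplace0// /tilt mul0r oppr0 expR0 !mulr1.
  have -> : 1 - 4^-1 = 3 / 4 :> R by field.
  have -> : 3 / 2 = 2 * (3 / 4) :> R by field.
  by rewrite exprMn -[X in _ * _ ^+ X = _]kN exprD exprMn; ring.
have lik2 : (2 * balanced_prob) ^+ N = expR (k%:R * m) *
    (2 ^+ N * balanced_prob ^+ k *
     (1 - balanced_prob * laplace g 1) ^+ (N - k) * tilt 1 (k%:R * m)).
  have -> : 1 - balanced_prob * laplace g 1 = balanced_prob.
    have G0 : 1 + laplace g 1 != 0 by rewrite gt_eqF// addr_gt0// laplace_gt0.
    by rewrite /balanced_prob; field.
  rewrite -[_ * _ * balanced_prob ^+ (N - k)]mulrA -exprD kN -exprMn.
  by rewrite mulrCA /tilt mul1r -expRD subrr expR0 mulr1.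
have lik1_gt0 : 0 < 2 ^+ N * 4^-1 ^+ k *
    (1 - 4^-1 * laplace g 0) ^+ (N - k) * tilt 0 (k%:R * m).
  rewrite -(pmulr_rgt0 _ (exprn_gt0 k (ltr0n _ 3))) -lik1.
  by rewrite exprn_gt0//; lra.
have lik2_gt0 : 0 < 2 ^+ N * balanced_prob ^+ k *
    (1 - balanced_prob * laplace g 1) ^+ (N - k) * tilt 1 (k%:R * m).
  rewrite -(pmulr_rgt0 _ (expR_gt0 (k%:R * m))) -lik2.
  by rewrite exprn_gt0// mulr_gt0.
rewrite /decode lik1 lik2 !lnMB ?exprn_gt0 ?expR_gt0// expRK lnXn//.
rewrite -[ln 3 *+ k]mulr_natl mulfK; last by rewrite gt_eqF// ln_gt0 ?ltr1n.
rewrite natrK; congr pair; case: eqP => [k0|/eqP k0].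
  by rewrite /m /mean_length -/k k0.
by rewrite mulrC mulKf// pnatr_eq0.
Qed.

End decoding.

(** * Minimal sufficiency *)

Lemma waxman_size_le (R : realType) (N : nat) (g : R -> R) (q s : R)
    (P : probability (finseq R) R) : is_density_pos g ->
  0 < q <= 1 -> 0 <= s -> waxman_law N g q s P ->
  {ae P, forall d, (size d <= N)%N}.
Proof.
move=> hg q01 s0 [hsize _].
exists [set d : finseq R | [set k | (N < k)%N] (size d)]; split.
- by rewrite -[X in measurable X]setTI; exact: measurable_size.
- rewrite [LHS]hsize /binomial_prob edge_prob_itv// esum1// => k /= Nk.
  by rewrite /binomial_pmf bin_small.
- by move=> d /= /negP; rewrite -ltnNge.
Qed.

Theorem mainTheorem4 (R : realType) (n : nat) (hn : (2 <= n)%N)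
    (g : R -> R) (hg : is_density_pos g)
    (P : R * R -> probability (finseq R) R)
    (hP : forall q s : R, 0 < q <= 1 -> 0 <= s ->
            waxman_law ((n * (n - 1)) %/ 2) g q s (P (q, s)))
    (c : R) :
  minimal_sufficient (@waxman_params R) P (edge_stat c).
Proof.
move: hP; set N := ((n * (n - 1)) %/ 2)%N => hP.
pose th0 : R * R := (2^-1, 0).
have half01 : 0 < (2^-1 : R) <= 1 by lra.
have Tth0 : waxman_params th0 by [].
have hP0 := hP _ _ half01 (lexx 0).
have density th : waxman_params th -> forall A, measurable A ->
    (P th A = \int[P th0]_(d in A) (likelihood N g th (edge_stat c d))%:E)%E.
  by case: th => q s [/= q01 s0]; exact: (waxman_density hg c q01 s0 (hP _ _ q01 s0) hP0).
have mlik th : measurable_fun [set: finseq R] (likelihood N g th \o edge_stat c).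
  apply: (measurableT_comp (measurable_likelihood N g th)).
  exact: measurable_edge_stat.
have lik0 th d : waxman_params th -> 0 <= likelihood N g th (edge_stat c d).
  exact: likelihood_ge0.
split.
  apply: (factorization_sufficient (th0 := th0) (phi := likelihood N g)) => //.
  - exact: measurable_edge_stat.
  - by move=> th _; exact: measurable_likelihood.
  - by move=> th y; exact: likelihood_ge0.
move=> dZ Z S' suffS'.
have dominated th : waxman_params th -> P th `<< P th0.
  move=> Tth; apply/null_content_dominatesP => A mA A0.
  apply: (etrans (density _ Tth _ mA)); apply: null_set_integral => //.
  by apply: measurable_funTS; apply/measurable_EFinP; exact: mlik.
have likelihood_of_S' th : waxman_params th -> exists psi : Z -> R,
    measurable_fun [set: Z] psi /\
    {ae P th0, forall d, likelihood N g th (edge_stat c d) = psi (S' d)}.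
  move=> Tth; apply: (sufficient_density suffS' Tth0 Tth) => //.
  - exact: mlik.
  - by move=> d; exact: lik0.
  - exact: density.
have quarter01 : 0 < (4^-1 : R) <= 1 by lra.
have [psi1 [mpsi1 psi1E]] := likelihood_of_S' (4^-1, 0) (conj quarter01 (lexx 0)).
have [psi2 [mpsi2 psi2E]] := likelihood_of_S' (balanced_prob g, 1)
  (conj (balanced_prob_itv hg) ler01).
exists (fun z => decode ((3 / 2) ^+ N) ((2 * balanced_prob g) ^+ N) c
  (psi1 z) (psi2 z)).
split; first exact: measurable_decode.
move=> th Tth.
suff : ae_eq (P th) [set: finseq R] (edge_stat c) (fun d =>
    decode ((3 / 2) ^+ N) ((2 * balanced_prob g) ^+ N) c (psi1 (S' d)) (psi2 (S' d))).
  by apply: filterS => d /(_ Logic.I).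
apply: (null_dominates_ae_eq measurableT (dominated _ Tth)).
have sizeN := waxman_size_le hg half01 (lexx 0) hP0.
apply: filterS3 psi1E psi2E sizeN => d <- <- dN _.
exact: edge_stat_decode.
Qed.
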